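(* Let $p>3$ be a prime with $p\equiv 3 \bmod 4$, let $\zeta$ be a primitive $p$th root of unity in $\mathbb{C}$, let $\alpha$ be a primitive element of $\mathbb{F}_p$, and let $\Phi_p$ be the Paley ETF. Let $M=\operatorname{diag}(\zeta^{\alpha^0},\zeta^{\alpha^2},\dots,\zeta^{\alpha^{p-3}})$ and let $T=T_{(p-1)/2}$ be the cyclic translation matrix of size $(p-1)/2$. Then $$G:=\{M^kT^\ell : k\in\{0,\dots,p-1\},\ \ell\in\{0,\dots,(p-3)/2\}\}\cong \mathbb{Z}_p\rtimes\mathbb{Z}_{(p-1)/2}\cong\{f\in \operatorname{AGL}(\mathbb{F}_p) : f(x)=mx+b,\ b\in\mathbb{F}_p,\ m\in \operatorname{QR}(\mathbb{F}_p)\}$$ is the group of vector automorphisms of $\Phi_p$. The vector and line symmetry groups satisfy $\operatorname{Sym}_v(\Phi_p)=\operatorname{Sym}_\ell(\Phi_p)\cong G$. These symmetry groups act $2$-homogeneously but not $2$-transitively on the vectors, respectively the lines.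
   Context: $\mathbb{F}_p$ is the field with $p$ elements; a primitive element is a generator of the cyclic group $\mathbb{F}_p^\times$. $\operatorname{QR}(\mathbb{F}_p)=\{x^2: x\in\mathbb{F}_p^\times\}$. $\operatorname{AGL}(\mathbb{F}_p)$ is the group under composition of all maps $f:\mathbb{F}_p\to\mathbb{F}_p$, $f(x)=mx+b$, $m\in\mathbb{F}_p^\times$, $b\in\mathbb{F}_p$. In the semidirect product, $\mathbb{Z}_{(p-1)/2}\cong\operatorname{QR}(\mathbb{F}_p)$ acts on $\mathbb{Z}_p\cong(\mathbb{F}_p,+)$ by multiplication. Paley ETF: $\Phi_p$ is the $(p-1)/2\times p$ complex matrix with rows indexed, in this order, by the quadratic residues $\alpha^0,\alpha^2,\dots,\alpha^{p-3}$, columns indexed by $\mathbb{F}_p$, and entry $\zeta^{xy}$ in row $x$, column $y$. Its columns $(\varphi_y)_{y\in\mathbb{F}_p}$ are the frame vectors in $\mathbb{C}^{(p-1)/2}$; they form an equiangular tight frame. For $d\in\mathbb{N}$, $T_d$ is the $d\times d$ permutation matrix sending the $i$th standard basis vector to the $(i+1)$st, indices mod $d$ (ones on the subdiagonal and in the top right corner, zeros elsewhere). For a frame $\Phi=(\varphi_j)_{j=1}^n$ of $\mathbb{C}^d$, a unitary $U\in \operatorname{U}(d)$ is a vector automorphism if there is $\sigma\in S_n$ with $U\varphi_j=\varphi_{\sigma(j)}$ for all $j$; it is a line automorphism if there is $\sigma\in S_n$ with $U\varphi_j\varphi_j^*U^*=\varphi_{\sigma(j)}\varphi_{\sigma(j)}^*$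 for all $j$. The vector symmetry group $\operatorname{Sym}_v(\Phi)$ (resp. line symmetry group $\operatorname{Sym}_\ell(\Phi)$) is the subgroup of $S_n$ of permutations induced by vector (resp. line) automorphisms. Here the index set is $\mathbb{F}_p$. An action of a group on a set is $k$-transitive if any ordered $k$-tuple of distinct elements can be mapped by some group element to any other such ordered $k$-tuple; it is $k$-homogeneous if any $k$-element subset can be mapped by some group element onto any other $k$-element subset. *)

(* Defs.v *)
From HB Require Import structures.
From mathcomp Require Import all_boot all_order all_algebra all_fingroup.
From mathcomp Require Import all_solvable mxrepresentation spectral.
From mathcomp Require Import complex.
From mathcomp Require Import boolp reals.

Set Implicit Arguments.
Unset Strict Implicit.
Unset Printing Implicit Defensive.

Import Order.TTheory GRing.Theory Num.Theory.
Local Open Scope ring_scope.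
Local Open Scope sesquilinear_scope.

Section FrameSymmetry.
Variables (C : numClosedFieldType) (d : nat) (I : finType) (phi : I -> 'cV[C]_d).

Definition line (j : I) : 'M[C]_d := phi j *m (phi j)^t*.

Definition vector_induces (U : 'M[C]_d) (s : {perm I}) : Prop :=
  U \is unitarymx /\ forall j, U *m phi j = phi (s j).

Definition line_induces (U : 'M[C]_d) (s : {perm I}) : Prop :=
  U \is unitarymx /\ forall j, U *m line j *m U^t* = line (s j).

Definition vector_automorphism (U : 'M[C]_d) : Prop :=
  exists s : {perm I}, vector_induces U s.

Definition Sym_v : {set {perm I}} :=
  [set s | `[< exists U : 'M[C]_d, vector_induces U s >]].

Definition Sym_l : {set {perm I}} :=
  [set s | `[< exists U : 'M[C]_d, line_induces U s >]].

Lemma unitarymx1 : (1%:M : 'M[C]_d) \is unitarymx.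
Proof. by apply/unitarymxP; rewrite mul1mx trmx1 map_mx1. Qed.

Fact Sym_v_group_set : group_set Sym_v.
Proof.
apply/group_setP; split.
  rewrite inE; apply/asboolP; exists 1%:M; split; first exact: unitarymx1.
  by move=> j; rewrite mul1mx perm1.
move=> s t; rewrite !inE => /asboolP[U [uU Us]] /asboolP[V [uV Vt]].
apply/asboolP; exists (V *m U); split; first exact: mul_unitarymx.
by move=> j; rewrite -mulmxA Us Vt permM.
Qed.
Canonical Sym_v_group := Group Sym_v_group_set.

Fact Sym_l_group_set : group_set Sym_l.
Proof.
apply/group_setP; split.
  rewrite inE; apply/asboolP; exists 1%:M; split; first exact: unitarymx1.
  by move=> j; rewrite mul1mx trmx1 map_mx1 mulmx1 perm1.
move=> s t; rewrite !inE => /asboolP[U [uU Us]] /asboolP[V [uV Vt]].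
apply/asboolP; exists (V *m U); split; first exact: mul_unitarymx.
by move=> j; rewrite permM -Vt -Us trmx_mul map_mxM !mulmxA.
Qed.
Canonical Sym_l_group := Group Sym_l_group_set.

End FrameSymmetry.

(* [k]-transitivity is [ntransitive k] of [primitive_action]. *)
Definition homogeneous (T : finType) (k : nat) (G : {set {perm T}}) : Prop :=
  forall A B : {set T}, #|A| = k -> #|B| = k -> exists2 s, s \in G & s @: A = B.

(* [S], a set of matrices, is a group under [*m] with identity [1%:M], and is
   isomorphic to the finite group [H]: it is the image of an injective matrix
   representation of [H]. *)
Definition mx_isog (R : comUnitRingType) (n : nat) (S : 'M[R]_n -> Prop)
    (gT : finGroupType) (H : {group gT}) : Prop :=
  exists f : gT -> 'M[R]_n,
    [/\ mx_repr H f, {in H &, injective f}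
      & forall A, S A <-> exists2 x, x \in H & A = f x].

Section PrimeField.
Variable p : nat.

Definition QR : {set {unit 'F_p}} := [set (u ^+ 2)%g | u : {unit 'F_p}].

Fact QR_group_set : group_set QR.
Proof.
apply/group_setP; split; first by apply/imsetP; exists 1%g; rewrite ?expg1n.
move=> _ _ /imsetP[u _ ->] /imsetP[v _ ->]; apply/imsetP; exists (u * v)%g => //.
by rewrite expgMn //; apply/val_inj; rewrite /= mulrC.
Qed.
Canonical QR_group := Group QR_group_set.

Definition affine (s : {perm 'F_p}) (m : {unit 'F_p}) (b : 'F_p) : bool :=
  [forall x, s x == FinRing.uval m * x + b].

Definition AGL : {set {perm 'F_p}} := [set s | [exists m, exists b, affine s m b]].

Definition AGL_QR : {set {perm 'F_p}} :=
  [set s in AGL | [exists m in QR, exists b, affine s m b]].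

Lemma affine1 : affine 1%g 1%g 0.
Proof. by apply/forallP=> x; rewrite perm1 mul1r addr0. Qed.

Lemma affineM s t m n b c :
  affine s m b -> affine t n c -> affine (s * t)%g (n * m)%g (FinRing.uval n * b + c).
Proof.
move=> /forallP sP /forallP tP; apply/forallP => x.
by rewrite permM (eqP (tP _)) (eqP (sP _)) mulrDr mulrA addrA.
Qed.

Fact AGL_group_set : group_set AGL.
Proof.
apply/group_setP; split.
  by rewrite inE; apply/existsP; exists 1%g; apply/existsP; exists 0; exact: affine1.
move=> s t; rewrite !inE => /existsP[m /existsP[b sP]] /existsP[n /existsP[c tP]].
by apply/existsP; exists (n * m)%g; apply/existsP; exists (FinRing.uval n * b + c); exact: affineM.
Qed.
Canonical AGL_group := Group AGL_group_set.

Fact AGL_QR_group_set : group_set AGL_QR.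
Proof.
apply/group_setP; split.
  apply/setIdP; split; first exact: (group1 AGL_group).
  apply/existsP; exists 1%g; apply/andP; split; first exact: (group1 QR_group).
  by apply/existsP; exists 0; exact: affine1.
move=> s t /setIdP[sA /existsP[m /andP[mQ /existsP[b sP]]]].
case/setIdP=> tA /existsP[n /andP[nQ /existsP[c tP]]].
apply/setIdP; split; first exact: (groupM (G := AGL_group)).
apply/existsP; exists (n * m)%g.
apply/andP; split; first exact: (groupM (G := QR_group)).
by apply/existsP; exists (FinRing.uval n * b + c); exact: affineM.
Qed.
Canonical AGL_QR_group := Group AGL_QR_group_set.

(* The semidirect product of the additive group ['F_p] by ['Z_n], where ['Z_n]
   acts through [iota] and multiplication by units (['U]). *)
Definition Fp_sdprod (n : nat) (iota : {morphism Zp n >-> {unit 'F_p}}) :=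
  [set: sdprod_by ('U \o iota)%gact].

End PrimeField.

Section Paley.
Variables (C : numClosedFieldType) (p : nat) (zeta : C) (alpha : {unit 'F_p}).
Local Notation d := (p.-1./2).

Definition paley_row (i : 'I_d) : 'F_p := FinRing.uval (alpha ^+ i.*2)%g.

(* ['F_p] is by definition ['I_(Zp_trunc (pdiv p)).+2], so its elements index the
   columns; in an exponent of [zeta], they stand for their representative in nat. *)
Definition paley_mx : 'M[C]_(d, (Zp_trunc (pdiv p)).+2) :=
  \matrix_(i, y) zeta ^+ (paley_row i * y)%R.

Definition paley_frame (y : 'F_p) : 'cV[C]_d := col y paley_mx.

Definition modulation : 'M[C]_d :=
  diag_mx (\row_i zeta ^+ paley_row i).

End Paley.

Definition translation (R : nzRingType) (n : nat) : 'M[R]_n :=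
  \matrix_(i, j) ((i == j.+1 %% n :> nat)%N)%:R.

Definition paley_group (C : numClosedFieldType) (p : nat) (zeta : C)
    (alpha : {unit 'F_p}) (A : 'M[C]_(p.-1./2)) : Prop :=
  exists k l : nat, [/\ (k < p)%N, (l < p.-1./2)%N
    & A = modulation zeta alpha ^+ k *m translation C p.-1./2 ^+ l].

(* Main.v *)
Require Import Defs.
From HB Require Import structures.
From mathcomp Require Import all_boot all_order all_algebra all_fingroup.
From mathcomp Require Import all_solvable mxrepresentation spectral.
From mathcomp Require Import complex.
From mathcomp Require Import boolp reals.
From mathcomp Require Import finfield zify ring.

(** Write d = (p-1)/2, and let S(t) be the sum of zeta^(ut) over the quadratic
residues u modulo p. Then S(y - x) is the inner product of the frame vectors
labelled x and y.

The matrices M and T permute the frame vectors by y |-> y + 1 and by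
y |-> alpha^-2 y, so M^k T^l acts on the labels by y |-> alpha^(-2l) y + k, and
every affine map whose slope is a quadratic residue arises in this way
([AGL_QR_paley], [paley_AGL_QR]). Since the frame is tight it spans, so a
matrix is determined by the permutation that it induces. Hence everything
follows from the inclusion of the line symmetry group in AGL_QR
([Sym_l_sub_AGL_QR]), whose proof has two halves.

First half: a line symmetry s satisfies S(s x - s y) = S(x - y). As p = 3 mod 4,
-1 is not a square, so S takes only the values a = S(1) and its conjugate b on
nonzero arguments, and a + b = -1, ab = (p + 1)/4. The traces of products of
three lines are invariant under s, that is, the products
S(y - x) S(z - y) S(x - z) are. As p > 3, no two of a^3, a^2 b, a b^2, b^3 are
equal, so the product determines how many factors are equal to a, and therefore
the sum S(y - x) + S(z - y) + S(x - z) is invariant as well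
([residue_sum_cocycle]). Summing over z leaves p S(y - x), because the values of
S add up to zero ([residue_sum_rigid]).

Second half: by Euler's criterion s now satisfies (s x - s y)^d = (x - y)^d in
F_p, and this forces s to be affine ([power_preserving_affine], a theorem of
Carlitz). Indeed every power t^k with k <= d is a linear combination of the
translates (t - y)^d. Substituting t = s x shows that (s x)^k is a polynomial in
x of degree at most d for each k <= d; were deg s >= 2, some power s^k with
k <= d would have degree strictly between d and p.

Of two opposite nonzero elements exactly one is a square. Thus every pair can be
ordered so that its difference is a square, which gives 2-homogeneity, while the
swap of 0 and 1 would need the slope -1, which excludes 2-transitivity. *)

Set Implicit Arguments.
Unset Strict Implicit.
Unset Printing Implicit Defensive.

Import Order.TTheory GRing.Theory Num.Theory.
Local Open Scope ring_scope.
Local Open Scope sesquilinear_scope.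

(** * Products of three factors taken from two values *)

Section ThreeFactors.
Variables (F : fieldType) (a b : F).
Hypotheses (a0 : a != 0) (b0 : b != 0).
Hypothesis ab : forall m, (0 < m <= 3)%N -> a ^+ m != b ^+ m.

(** Cancelling the common factors leaves [a ^+ m = b ^+ m] with [m] the difference
of [k] and [l]. *)
Lemma power_product_inj (k l : nat) : (k <= 3)%N -> (l <= 3)%N ->
  a ^+ k * b ^+ (3 - k) = a ^+ l * b ^+ (3 - l) -> k = l.
Proof.
wlog kl : k l / (k < l)%N => [wl k3 l3 akl | k3 l3 akl].
  by case: (ltngtP k l) => // kl; [exact: wl | apply/esym/wl].
have m3 : (0 < l - k <= 3)%N by lia.
case/eqP: (ab m3); apply: (mulfI (expf_neq0 k a0)).
apply: (mulIf (expf_neq0 (3 - l) b0)).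
rewrite -exprD subnKC ?(ltnW kl) // -akl -!mulrA -exprD.
by congr (_ * _ ^+ _); lia.
Qed.

(** By [power_product_inj] the product determines the number of factors equal
to [a], hence also the sum. *)
Lemma sum_of_product (u v w x y z : F) :
    all (mem [:: a; b]) [:: u; v; w; x; y; z] ->
  u * v * w = x * y * z -> u + v + w = x + y + z.
Proof.
pose pick (c : bool) := if c then a else b.
have pickP (t : F) : t \in [:: a; b] -> exists c, t = pick c.
  by rewrite !inE => /orP[] /eqP ->; [exists true | exists false].
have prodE (c1 c2 c3 : bool) : pick c1 * pick c2 * pick c3
    = a ^+ (c1 + c2 + c3) * b ^+ (3 - (c1 + c2 + c3)).
  by case: c1 c2 c3 => [] [] [];
    rewrite /pick /= ?(addSn, add0n, subSS, sub0n, subn0); ring.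
have sumE (c1 c2 c3 : bool) : pick c1 + pick c2 + pick c3
    = a *+ (c1 + c2 + c3) + b *+ (3 - (c1 + c2 + c3)).
  by case: c1 c2 c3 => [] [] [];
    rewrite /pick /= ?(addSn, add0n, subSS, sub0n, subn0); ring.
have le3 (c1 c2 c3 : bool) : (c1 + c2 + c3 <= 3)%N by case: c1 c2 c3 => [] [] [].
case/and5P => /pickP[c1 ->] /pickP[c2 ->] /pickP[c3 ->] /pickP[e1 ->].
case/and3P => /pickP[e2 ->] /pickP[e3 ->] _.
by rewrite !prodE => /power_product_inj; rewrite !sumE => -> //; exact: le3.
Qed.

End ThreeFactors.

(** * Power sums over a finite field *)

Section PowerSums.
Variable F : finFieldType.

Lemma expf_card_pred (x : F) : x != 0 -> x ^+ #|F|.-1 = 1.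
Proof.
move=> x0; apply: (mulfI x0).
by rewrite -exprS (ltn_predK (finNzRing_gt1 F)) expf_card mulr1.
Qed.

(** Multiplying the summation variable by a primitive element [u] multiplies the
sum by [u ^+ m], which is not 1. *)
Lemma sum_expf_eq0 (m : nat) : ~~ (#|F|.-1 %| m)%N -> \sum_(x : F) x ^+ m = 0.
Proof.
move=> ndvd.
have /cyclicP[u def_u] := field_unit_group_cyclic [set: {unit F}].
have ou : #[u]%g = #|F|.-1 by rewrite orderE -def_u card_finField_unit.
set c : F := FinRing.uval u ^+ m.
have c1 : c != 1.
  rewrite /c -FinRing.val_unitX; apply: contraNneq ndvd => um1.
  by rewrite -ou order_dvdn; apply/eqP/val_inj.
have u0 : FinRing.uval u != 0 by rewrite -unitfE (valP u).
have : c * \sum_(x : F) x ^+ m = \sum_(x : F) x ^+ m.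
  rewrite [RHS](reindex_inj (mulfI u0)) mulr_sumr.
  by apply: eq_bigr => x _; rewrite exprMn.
move/eqP; rewrite -subr_eq0 -{2}[\sum_x _]mul1r -mulrBl mulf_eq0 subr_eq0.
by rewrite (negPf c1) => /eqP.
Qed.

Lemma sum_expf_card_pred : \sum_(x : F) x ^+ #|F|.-1 = -1.
Proof.
have q1 := finNzRing_gt1 F.
have qm1 : (#|F|.-1 == 0)%N = false by case: (#|F|) q1 => [|[]].
(* Translation by 1 permutes F, so that the sum of |F| ones is zero. *)
have sum1 : \sum_(x : F) 1 = 0 :> F.
  apply: (addrI (\sum_(x : F) x)); rewrite -big_split addr0.
  by rewrite [RHS](reindex_inj (addIr 1)).
rewrite (bigD1 0) //= expr0n qm1 add0r.
rewrite (eq_bigr (fun=> 1)) => [|x]; last exact: expf_card_pred.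
by apply: (addrI 1); rewrite subrr -[RHS]sum1 [RHS](bigD1 0).
Qed.

End PowerSums.

(** * Maps of F_p that preserve a power of all differences *)

Lemma poly_eq_of_evals (F : finFieldType) (f g : {poly F}) :
  (size f <= #|F|)%N -> (size g <= #|F|)%N -> (forall x, f.[x] = g.[x]) -> f = g.
Proof.
move=> sf sg fg; apply/eqP; rewrite -subr_eq0; apply/eqP.
apply: (@roots_geq_poly_eq0 _ _ (enum F)).
- by apply/allP => x _; rewrite rootE !hornerE fg subrr.
- exact: enum_uniq.
- by rewrite -cardE (leq_trans (size_polyD _ _)) // size_polyN geq_max sf.
Qed.

Lemma prime_ndvd_fact (p n : nat) : prime p -> (n < p)%N -> ~~ (p %| n`!)%N.
Proof.
move=> p_prime; elim: n => [_|n IHn np]; first by rewrite dvdn1 gtn_eqF ?prime_gt1.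
by rewrite factS Euclid_dvdM // negb_or gtnNdvd //= IHn // ltnW.
Qed.

Section PowerDifferences.
Variables (p d : nat) (f : 'F_p -> 'F_p).
Hypotheses (p_prime : prime p) (d_gt1 : (1 < d)%N) (d_small : (d.*2 < p)%N).
Hypothesis fP : forall x y, (f x - f y) ^+ d = (x - y) ^+ d.

Lemma power_preserving_inj : injective f.
Proof.
move=> x y fxy; have := fP x y; rewrite fxy subrr expr0n gtn_eqF ?(ltnW d_gt1) //.
by move/esym/eqP; rewrite expf_eq0 subr_eq0 => /andP[_ /eqP].
Qed.

(** Expanding the binomial yields the power sums of exponents [p.-1 - k + i] with
[i <= d]. Since [2 * d < p], the only multiple of [p.-1] among them is [p.-1]
itself, so that only the term [i = k] survives. *)
Lemma power_as_sum (k : nat) (x : 'F_p) : (k <= d)%N ->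
  \sum_(y : 'F_p) y ^+ (p.-1 - k) * (x - y) ^+ d
    = - ((-1) ^+ k * x ^+ (d - k) *+ 'C(d, k)).
Proof.
move=> kd; have p0 := prime_gt0 p_prime.
have oF := card_Fp p_prime.
transitivity (\sum_(i < d.+1) ((-1) ^+ i * x ^+ (d - i) *+ 'C(d, i))
                 * \sum_(y : 'F_p) y ^+ (p.-1 - k + i)).
  under eq_bigr do rewrite exprBn mulr_sumr.
  rewrite exchange_big; apply: eq_bigr => i _; rewrite mulr_sumr.
  by apply: eq_bigr => y _; rewrite exprD mulrnAr mulrnAl mulrCA.
have kd' : (k < d.+1)%N by [].
rewrite (bigD1 (Ordinal kd')) //= [X in _ + X]big1 => [|i ik].
  have -> : (p.-1 - k + k = #|'F_p|.-1)%N by rewrite oF; lia.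
  by rewrite sum_expf_card_pred mulrN1 addr0.
rewrite sum_expf_eq0 ?mulr0 // oF; apply/negP => /dvdnP[q hq].
have {}ik : nat_of_ord i <> k by move=> ik'; case/eqP: ik; exact/val_inj.
have i_le_d := ltn_ord i.
case: q hq => [|[|q]]; rewrite ?mulSn ?mul0n; [lia | lia |].
by move: (q * p.-1)%N; lia.
Qed.

(** In [power_as_sum] at the point [f x], reindexing by [f] turns
[(f x - f y) ^+ d] into [(x - y) ^+ d], a polynomial of degree [d] in [x]. *)
Lemma power_poly (k : nat) : (k <= d)%N ->
  exists2 g : {poly 'F_p}, (size g <= d.+1)%N & forall x, g.[x] = f x ^+ k.
Proof.
move=> kd.
set c : 'F_p := - ((-1) ^+ (d - k) *+ 'C(d, d - k)).
have c0 : c != 0.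
  (* The binomial coefficient divides d!, and d < p. *)
  rewrite /c oppr_eq0 -mulr_natr mulf_neq0 ?signr_eq0 //.
  rewrite -(dvdn_pcharf (pchar_Fp p_prime)).
  apply: contra (prime_ndvd_fact p_prime (n := d) _) => [dvd_bin|]; last by lia.
  by rewrite -(bin_fact (leq_subr k d)) dvdn_mulr.
exists (c^-1 *: \sum_(y : 'F_p) (f y ^+ (p.-1 - (d - k))) *: ('X - y%:P) ^+ d).
  rewrite (leq_trans (size_scale_leq _ _)) // (leq_trans (size_sum _ _ _)) //.
  apply/bigmax_leqP => y _; rewrite (leq_trans (size_scale_leq _ _)) //.
  by rewrite size_exp_XsubC.
move=> x; rewrite hornerZ horner_sum; apply: (mulfI c0); rewrite mulVKf //.
rewrite /c mulNr mulrnAl.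
have := power_as_sum (f x) (leq_subr k d); rewrite subKn // => <-.
rewrite [RHS](reindex_inj power_preserving_inj).
by apply: eq_bigr => y _; rewrite !hornerE fP.
Qed.

(** For [d = (p - 1) / 2] this is a theorem of Carlitz. A polynomial [g] of degree
[e >= 2] representing [f] would have a power [g ^+ k] with [k <= d] whose degree
exceeds [d] but stays below [p]; such a polynomial is determined by its values,
which contradicts [power_poly]. *)
Lemma power_preserving_affine : exists m b, forall x, f x = m * x + b.
Proof.
have oF := card_Fp p_prime.
have [g sg gE] := power_poly (ltnW d_gt1).
have {gE} gE x : g.[x] = f x by rewrite gE.
have sg2 : (size g <= 2)%N.
  rewrite leqNgt; apply/negP => sg2.
  (* The least k with e * k > d; then e * k <= d + e <= 2 * d. *)
  set e := (size g).-1; set k := (d %/ e).+1.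
  have kd : (k <= d)%N by rewrite /k /e; nia.
  have [h sh hE] := power_poly kd.
  have sgk : (size (g ^+ k)).-1 = (e * k)%N by exact: size_exp.
  have ek : (d < e * k <= d.*2)%N by rewrite /k /e; nia.
  have gh : g ^+ k = h.
    apply: poly_eq_of_evals => [||x]; rewrite ?oF ?hE ?horner_exp ?gE //.
      by rewrite (leq_trans (leqSpred _)) // sgk; lia.
    by rewrite (leq_trans sh) //; lia.
  have : (e * k <= d)%N by rewrite -sgk gh -subn1 leq_subLR.
  lia.
exists g`_1, g`_0 => x; rewrite -gE (horner_coef_wide x sg2).
by rewrite !big_ord_recl big_ord0 /= addr0 expr0 mulr1 expr1 addrC mulrC.
Qed.

End PowerDifferences.

(** * Induced permutations and matrix groups *)

Lemma vector_line_induces (C : numClosedFieldType) (d : nat) (I : finType)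
    (phi : I -> 'cV[C]_d) (U : 'M[C]_d) (s : {perm I}) :
  vector_induces phi U s -> line_induces phi U s.
Proof.
move=> [uU Us]; split=> // j.
by rewrite /line -Us trmx_mul map_mxM !mulmxA.
Qed.

Lemma mx_isog_isog (R : comUnitRingType) (n : nat) (S : 'M[R]_n -> Prop)
    (gT hT : finGroupType) (H : {group gT}) (K : {group hT}) :
  mx_isog S H -> K \isog H -> mx_isog S K.
Proof.
case=> f [[f1 fM] f_inj Sf] /isogP[g g_inj gK].
have gH x : x \in K -> g x \in H by move=> xK; rewrite -gK mem_morphim.
exists (f \o g); split.
- split=> [|x y xK yK] /=; first by rewrite morph1.
  by rewrite morphM // fM ?gH.
- by move=> x y xK yK /= /f_inj/(injmP g_inj); apply; rewrite ?gH.
move=> A; split=> [/Sf[y]|[x xK ->]].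
  by rewrite -{1}gK => /morphimP[x _ xK ->] ->; exists x.
by apply/Sf; exists (g x); rewrite ?gH.
Qed.

(** * Quadratic residues modulo p *)

Section Paley.
Variable p : nat.
Hypotheses (p_gt3 : (3 < p)%N) (p_mod4 : (p %% 4 = 3)%N).
Local Notation d := (p.-1./2).

Lemma half_double : d.*2 = p.-1. Proof. lia. Qed.
Lemma half_odd : odd d. Proof. lia. Qed.
Lemma half_gt1 : (1 < d)%N. Proof. lia. Qed.

Hypothesis p_prime : prime p.

Lemma uval_neq0 (u : {unit 'F_p}) : FinRing.uval u != 0.
Proof. by rewrite -unitfE (valP u). Qed.

Lemma uval_inj : injective (@FinRing.uval 'F_p).
Proof. exact: val_inj. Qed.

Lemma unit_of (t : 'F_p) : t != 0 -> exists u : {unit 'F_p}, FinRing.uval u = t.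
Proof. by move=> t0; exists (finField_unit t0). Qed.

Lemma card_units : #|[set: {unit 'F_p}]| = p.-1.
Proof. by rewrite card_finField_unit card_Fp. Qed.

Lemma QR_expE (u : {unit 'F_p}) : (u \in QR p) = (u ^+ d == 1)%g.
Proof.
apply/imsetP/eqP => [[v _ ->]|ud1].
  by rewrite -expgM mul2n half_double -card_units expg_cardG ?inE.
have /cyclicP[g def_g] := field_unit_group_cyclic [set: {unit 'F_p}].
have og : #[g]%g = p.-1 by rewrite orderE -def_g card_units.
have /cycleP[n un] : u \in <[g]>%g by rewrite -def_g inE.
exists (g ^+ n./2)%g => //; rewrite -expgM muln2 un.
move/eqP: ud1; rewrite un -expgM -order_dvdn og.
rewrite -[X in (X %| _)%N]half_double -mul2n dvdn_pmul2r ?(ltnW half_gt1) //.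
by rewrite dvdn2 => n_even; rewrite even_halfK.
Qed.

Lemma euler_dichotomy (t : 'F_p) : t != 0 -> t ^+ d = 1 \/ t ^+ d = -1.
Proof.
move=> t0; have /eqP : t ^+ d ^+ 2 = 1.
  by have := expf_card_pred t0; rewrite card_Fp // -exprM muln2 half_double.
by rewrite sqrf_eq1 => /orP[] /eqP td; [left | right].
Qed.

Lemma opp_exp_half (t : 'F_p) : (- t) ^+ d = - t ^+ d.
Proof. by rewrite exprNn -signr_odd half_odd expr1 mulN1r. Qed.

Lemma QR_exp_half (u : {unit 'F_p}) : (u \in QR p) = (FinRing.uval u ^+ d == 1).
Proof.
by rewrite QR_expE -FinRing.val_unitX -FinRing.val_unit1 (inj_eq uval_inj).
Qed.

Lemma neg1_neq1 : -1 != 1 :> 'F_p.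
Proof.
rewrite -subr_eq0 -opprD oppr_eq0 -(natrD _ 1 1).
by rewrite -(dvdn_pcharf (pchar_Fp p_prime)) gtnNdvd //; lia.
Qed.

(** This is where [p = 3 mod 4] enters: [d] is odd, so [(- t) ^+ d = - t ^+ d]. *)
Lemma one_of_opp_square (t : 'F_p) : t != 0 -> (t ^+ d == 1) (+) ((- t) ^+ d == 1).
Proof.
move=> t0; rewrite opp_exp_half; have n1 := neg1_neq1.
by case: (euler_dichotomy t0) => ->; rewrite ?opprK ?eqxx ?(negPf n1).
Qed.

Lemma square_neq0 (t : 'F_p) : t ^+ d == 1 -> t != 0.
Proof.
apply: contraTneq => ->.
by rewrite expr0n gtn_eqF ?(ltnW half_gt1) // eq_sym oner_eq0.
Qed.

(** The nonzero elements are the squares and their opposites. *)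
Lemma sum_units (V : zmodType) (h : 'F_p -> V) :
  \sum_(t : 'F_p) h t = h 0
    + \sum_(u in QR p) (h (FinRing.uval u) + h (- FinRing.uval u)).
Proof.
have sumQR (k : 'F_p -> V) :
  \sum_(u in QR p) k (FinRing.uval u) = \sum_(t : 'F_p | t ^+ d == 1) k t.
  rewrite -(big_imset k (in2W uval_inj)); apply: eq_bigl => t.
  apply/imsetP/idP => [[u uQR ->]|td]; first by rewrite -QR_exp_half.
  by have [u ut] := unit_of (square_neq0 td); exists u; rewrite // QR_exp_half ut.
rewrite (bigD1 0) //=; congr (_ + _).
rewrite big_split /= (sumQR h) (sumQR (fun t => h (- t))).
rewrite [X in _ = _ + X](reindex_inj oppr_inj) /=.
rewrite (bigID (fun t : 'F_p => t ^+ d == 1)) /=; congr (_ + _).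
  by apply: eq_bigl => t; rewrite andb_idl //; exact: square_neq0.
apply: eq_big => [t|t _]; last by rewrite opprK.
case: (eqVneq t 0) => [->|t0] /=; last first.
  by have := one_of_opp_square t0; do 2 case: (_ == 1).
by rewrite oppr0; apply/esym/negP => /square_neq0 /eqP.
Qed.

Variable alpha : {unit 'F_p}.
Hypothesis alpha_prim : generator [set: {unit 'F_p}] alpha.

Lemma order_alpha : #[alpha]%g = p.-1.
Proof. by rewrite orderE -card_units (eqP alpha_prim). Qed.

Lemma order_alpha2 : #[alpha ^+ 2]%g = d.
Proof.
by rewrite orderXdiv order_alpha ?divn2 // -half_double -muln2 dvdn_mull.
Qed.

Lemma QR_cycle : QR p = <[alpha ^+ 2]>%g.
Proof.
apply/setP => u; apply/imsetP/cycleP => [[v _ ->]|[n ->]].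
  have /cycleP[n ->] : v \in <[alpha]>%g by rewrite -(eqP alpha_prim) inE.
  by exists n; rewrite -!expgM mulnC.
by exists (alpha ^+ n)%g => //; rewrite -!expgM mulnC.
Qed.

Lemma card_QR : #|QR p| = d.
Proof. by rewrite QR_cycle -orderE order_alpha2. Qed.

Lemma QR_isog : Zp d \isog QR p.
Proof. by rewrite QR_cycle -order_alpha2 Zp_isog. Qed.

Lemma sum_QR (V : nmodType) (h : {unit 'F_p} -> V) :
  \sum_(u in QR p) h u = \sum_(i < d) h (alpha ^+ i.*2)%g.
Proof.
have injX : injective (fun i : 'I_d => (alpha ^+ i.*2)%g).
  have lt2 (i : 'I_d) : (i.*2 < p.-1)%N by have := ltn_ord i; lia.
  move=> i j /eqP; rewrite eq_expg_mod_order order_alpha !modn_small //.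
  by rewrite (inj_eq double_inj) => /eqP/val_inj.
rewrite -(big_imset h (in2W injX)) /=; apply: eq_bigl => u.
rewrite QR_cycle; apply/cycleP/imsetP => [[n ->]|[i _ ->]].
  exists (Ordinal (ltn_pmod n (ltnW half_gt1))) => //=.
  by rewrite -muln2 mulnC expgM -order_alpha2 expg_mod_order.
by exists i; rewrite -expgM mul2n.
Qed.

(** * The sums of zeta^(ut) over the quadratic residues u *)

Variables (C : numClosedFieldType) (zeta : C).
Hypothesis zeta_prim : p.-primitive_root zeta.

Definition add_char (t : 'F_p) : C := zeta ^+ t.

Lemma add_charD s t : add_char (s + t) = add_char s * add_char t.
Proof.
have modFp n : (n %% (Zp_trunc (pdiv p)).+2 = n %% p)%N by rewrite Fp_cast.
by rewrite /add_char -exprD /= modFp (prim_expr_mod zeta_prim).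
Qed.

Lemma add_char0 : add_char 0 = 1.
Proof. by rewrite /add_char expr0. Qed.

Lemma add_char_eq1 t : (add_char t == 1) = (t == 0).
Proof.
rewrite /add_char -(prim_order_dvd zeta_prim) -val_eqE /=.
have := ltn_ord t; rewrite [X in (_ < X)%N -> _]Fp_cast //.
case: (nat_of_ord t) => [|n] ltp; first by rewrite dvdn0.
by rewrite gtnNdvd.
Qed.

Lemma add_char_neq0 t : add_char t != 0.
Proof. by rewrite expf_neq0 // (prim_root_eq0 zeta_prim) -lt0n prime_gt0. Qed.

Lemma add_charC t : (add_char t)^* = add_char (- t).
Proof.
apply: (mulfI (add_char_neq0 t)); rewrite -add_charD subrr add_char0 -normCK normrX.
suff -> : `|zeta| = 1 by rewrite !expr1n.
apply/eqP; rewrite -(@pexpr_eq1 _ _ p) ?prime_gt0 //.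
by rewrite -normrX (prim_expr_order zeta_prim) normr1.
Qed.

Lemma sum_add_char t :
  \sum_(x : 'F_p) add_char (x * t) = if t == 0 then p%:R else 0.
Proof.
case: eqVneq => [->|t0].
  under eq_bigr do rewrite mulr0 add_char0.
  by rewrite sumr_const card_Fp.
have : add_char t * (\sum_(x : 'F_p) add_char (x * t))
    = \sum_(x : 'F_p) add_char (x * t).
  rewrite [RHS](reindex_inj (addrI 1)) mulr_sumr.
  by apply: eq_bigr => x _; rewrite mulrDl mul1r add_charD.
move/eqP; rewrite -subr_eq0 -{2}[\sum_x _]mul1r -mulrBl mulf_eq0 subr_eq0.
by rewrite add_char_eq1 (negPf t0) => /eqP.
Qed.

(** For nonzero [t] these are the two quadratic Gaussian periods. *)
Definition residue_sum (t : 'F_p) : C :=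
  \sum_(u in QR p) add_char (FinRing.uval u * t).

Lemma residue_sum0 : residue_sum 0 = d%:R.
Proof.
rewrite /residue_sum; under eq_bigr do rewrite mulr0 add_char0.
by rewrite sumr_const card_QR.
Qed.

Lemma residue_sumC t : (residue_sum t)^* = residue_sum (- t).
Proof.
rewrite /residue_sum rmorph_sum.
by apply: eq_bigr => u _; rewrite /= add_charC mulrN.
Qed.

Lemma residue_sum_square t : t ^+ d = 1 -> residue_sum t = residue_sum 1.
Proof.
move=> td; have t0 : t != 0 by apply/square_neq0/eqP.
have [v vt] := unit_of t0.
have vQR : v \in QR p by rewrite QR_exp_half // vt td.
rewrite /residue_sum [RHS](reindex_inj (mulIg v)) /=.
apply: eq_big => u; first by rewrite groupMr.
by rewrite mulr1 vt.
Qed.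

(** Here [- t] is a square, and opposite arguments give conjugate values. *)
Lemma residue_sum_nonsquare t : t ^+ d = -1 -> residue_sum t = (residue_sum 1)^*.
Proof.
move=> td; rewrite -(@residue_sum_square (- t)).
  by rewrite residue_sumC opprK.
by rewrite opp_exp_half // td opprK.
Qed.

Lemma residue_sumP (t : 'F_p) : t != 0 ->
  residue_sum t \in [:: residue_sum 1; (residue_sum 1)^*].
Proof.
case/euler_dichotomy => [/residue_sum_square | /residue_sum_nonsquare] ->.
  exact: mem_head.
by rewrite !inE eqxx orbT.
Qed.

Lemma residue_sum_total : \sum_(t : 'F_p) residue_sum t = 0.
Proof.
rewrite exchange_big big1 // => u _.
under eq_bigr do rewrite mulrC.
by rewrite sum_add_char (negPf (uval_neq0 u)).
Qed.

Lemma residue_sum_trace : residue_sum 1 + (residue_sum 1)^* = -1.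
Proof.
have := sum_add_char 1; rewrite oner_eq0.
rewrite sum_units mul0r add_char0 => /eqP.
rewrite addrC addr_eq0 => /eqP <-; rewrite residue_sumC /residue_sum -big_split /=.
by apply: eq_bigr => u _; rewrite mulrN !mulr1.
Qed.

(** Parseval: evaluate the sum of [|residue_sum t|^2] over all [t] once by
orthogonality of characters, once value by value. *)
Lemma residue_sum_norm : residue_sum 1 * (residue_sum 1)^* *+ 4 = p.+1%:R.
Proof.
have sq t : t ^+ d = 1 ->
    residue_sum t * (residue_sum t)^* = residue_sum 1 * (residue_sum 1)^*.
  by move=> /residue_sum_square ->.
have parseval :
    \sum_(t : 'F_p) residue_sum t * (residue_sum t)^* = (p * d)%:R.
  transitivity (\sum_(u in QR p) \sum_(v in QR p) \sum_(t : 'F_p)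
                  add_char (t * (FinRing.uval u - FinRing.uval v))).
    under eq_bigr do rewrite residue_sumC mulr_suml.
    rewrite exchange_big; apply: eq_bigr => u _ /=.
    under eq_bigr do rewrite mulr_sumr.
    rewrite exchange_big; apply: eq_bigr => v _ /=.
    by apply: eq_bigr => t _; rewrite -add_charD mulrN -mulrBl mulrC.
  under eq_bigr => u uQR.
    rewrite (bigD1 u) //= subrr sum_add_char eqxx big1 ?addr0; last first.
      move=> v /andP[_ vu]; rewrite sum_add_char subr_eq0.
      by rewrite (inj_eq uval_inj) eq_sym (negPf vu).
    over.
  by rewrite sumr_const card_QR natrM mulr_natr.
move: parseval; rewrite sum_units residue_sum0 conjC_nat.
under eq_bigr => u uQR.
  rewrite [X in _ + X]mulrC -residue_sumC conjCK sq; last first.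
    by apply/eqP; rewrite -QR_exp_half.
  over.
rewrite sumr_const card_QR.
have d0 : d%:R != 0 :> C by rewrite pnatr_eq0 -lt0n ltnW // half_gt1.
have pE : p%:R = d%:R * 2 + 1 :> C.
  by rewrite -natrM muln2 half_double natr1 prednK ?prime_gt0.
set N := residue_sum 1 * _; rewrite natrM pE -[(N + N) *+ d]mulr_natr.
rewrite -[p.+1]addn1 natrD pE => h; apply: (mulfI d0).
move: (d%:R : C) N h {d0} => D N h.
transitivity ((D * D + (N + N) * D) * 2 - D * D * 2); first by ring.
by rewrite h; ring.
Qed.

Lemma residue_sum_opp t : t != 0 -> residue_sum t + residue_sum (- t) = -1.
Proof.
move=> t0; rewrite -residue_sumC -residue_sum_trace.
have := residue_sumP t0; rewrite !inE => /orP[] /eqP -> //.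
by rewrite conjCK addrC.
Qed.

Lemma residue_sum_normE : residue_sum 1 * (residue_sum 1)^* = p.+1%:R / 4.
Proof.
have n4 : 4 != 0 :> C by rewrite pnatr_eq0.
by rewrite -residue_sum_norm -mulr_natr mulfK.
Qed.

Local Notation rs1 := (residue_sum 1).

Lemma residue_sum1_neq0 : rs1 != 0.
Proof.
apply/eqP => r0; have := residue_sum_norm.
by rewrite r0 mul0r mul0rn => /esym/eqP; rewrite pnatr_eq0.
Qed.

(** Write [a] and [b] for the two values. The cubes differ because
[a^2 + a b + b^2 = (a + b)^2 - a b = 1 - (p + 1) / 4], which is zero only for
[p = 3]. *)
Lemma residue_sum1_powers m : (0 < m <= 3)%N -> rs1 ^+ m != rs1^* ^+ m.
Proof.
have := residue_sum_trace; have := residue_sum_norm.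
move: rs1^* => b; move: rs1 => a abN abT.
have ab : a - b != 0.
  apply/eqP => ab0; have : (a - b) ^+ 2 = - p%:R.
    transitivity ((a + b) ^+ 2 - a * b *+ 4); first by ring.
    by rewrite abN abT -natr1; ring.
  move/eqP; rewrite ab0 expr0n eq_sym oppr_eq0 pnatr_eq0 -leqn0 leqNgt.
  by rewrite prime_gt0.
have abs : a + b != 0 by rewrite abT oppr_eq0 oner_eq0.
case: m => [|[|[|[|]]]] // _; rewrite -subr_eq0.
- by rewrite !expr1.
- by rewrite subr_sqr mulf_neq0.
- have -> : a ^+ 3 - b ^+ 3 = (a - b) * ((a + b) ^+ 2 - a * b) by ring.
  rewrite mulf_neq0 //; apply/eqP => ab3.
  have : p.+1%:R = 4%:R :> C.
    rewrite -abN -[a * b](subrK ((a + b) ^+ 2)) -opprB ab3 oppr0 add0r abT.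
    by ring.
  by move/eqP; rewrite eqr_nat eqSS => /eqP pE; move: p_gt3; rewrite pE.
Qed.

Lemma residue_sum_exp (t u : 'F_p) : t != 0 -> u != 0 ->
  residue_sum t = residue_sum u -> t ^+ d = u ^+ d.
Proof.
have ne := residue_sum1_powers (isT : (0 < 1 <= 3)%N).
move=> /euler_dichotomy[] td /euler_dichotomy[] ud; rewrite td ud //.
  rewrite (residue_sum_square td) (residue_sum_nonsquare ud) => /eqP.
  by rewrite -[_ == _]/(rs1 ^+ 1 == rs1^* ^+ 1) (negPf ne).
rewrite (residue_sum_nonsquare td) (residue_sum_square ud) => /esym/eqP.
by rewrite -[_ == _]/(rs1 ^+ 1 == rs1^* ^+ 1) (negPf ne).
Qed.

(** * The frame vectors and their lines *)

Local Notation Phi := (paley_frame zeta alpha).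

Lemma paley_frameE (y : 'F_p) i : Phi y i 0 = add_char (paley_row alpha i * y).
Proof. by rewrite !mxE. Qed.

Lemma paley_row_inj : injective (@paley_row p alpha).
Proof.
move=> i j /uval_inj/eqP; rewrite -!mul2n !expgM.
rewrite eq_expg_mod_order order_alpha2 !modn_small //.
by move=> /eqP/val_inj.
Qed.

Lemma paley_gram (x y : 'F_p) : (Phi x)^t* *m Phi y = (residue_sum (y - x))%:M.
Proof.
apply/matrixP => i j; rewrite !ord1 !mxE eqxx mulr1n /residue_sum sum_QR.
apply: eq_bigr => k _; rewrite mxE mxE !paley_frameE add_charC -add_charD.
by rewrite mulrBr addrC.
Qed.

Lemma paley_tight : \sum_(y : 'F_p) Phi y *m (Phi y)^t* = p%:R%:M.
Proof.
apply/matrixP => i j; rewrite summxE mxE.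
under eq_bigr => y _.
  rewrite mxE big_ord1 !mxE -!/(add_char _) add_charC -add_charD -mulrBl mulrC.
  over.
by rewrite sum_add_char subr_eq0 (inj_eq paley_row_inj); case: eqP.
Qed.

(** The frame spans, because it is tight. *)
Lemma paley_frame_span (U V : 'M[C]_d) :
  (forall y, U *m Phi y = V *m Phi y) -> U = V.
Proof.
move=> UV; have : U *m (\sum_y Phi y *m (Phi y)^t* )
    = V *m (\sum_y Phi y *m (Phi y)^t* ).
  by rewrite !mulmx_sumr; apply: eq_bigr => y _; rewrite !mulmxA UV.
rewrite paley_tight !mul_mx_scalar; apply: scalerI.
by rewrite pnatr_eq0 -lt0n prime_gt0.
Qed.

Local Notation L := (line Phi).

Lemma line2_trace (x y : 'F_p) :
  \tr (L x *m L y) = residue_sum (y - x) * residue_sum (x - y).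
Proof.
rewrite /line mulmxA -[Phi x *m _ *m Phi y]mulmxA paley_gram mul_mx_scalar.
by rewrite -scalemxAl mxtraceZ mxtrace_mulC paley_gram mxtrace_scalar mulr1n.
Qed.

Lemma line3_trace (x y z : 'F_p) :
  \tr (L x *m L y *m L z)
    = residue_sum (y - x) * residue_sum (z - y) * residue_sum (x - z).
Proof.
rewrite /line !mulmxA -[Phi x *m _ *m Phi y]mulmxA paley_gram mul_mx_scalar.
rewrite -!scalemxAl -[Phi x *m _ *m Phi z]mulmxA paley_gram mul_mx_scalar.
rewrite -!scalemxAl !mxtraceZ mxtrace_mulC paley_gram mxtrace_scalar mulr1n.
by rewrite mulrA.
Qed.

Lemma paley_frame_inj : injective Phi.
Proof.
have d0 : (0 < d)%N by rewrite ltnW // half_gt1.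
move=> x y /matrixP/(_ (Ordinal d0) 0); rewrite !paley_frameE.
have -> : paley_row alpha (Ordinal d0) = 1 by [].
rewrite !mul1r.
move/eqP; rewrite -subr_eq0 => exy; apply/eqP; rewrite -subr_eq0 -add_char_eq1.
by rewrite -(inj_eq (mulIf (add_char_neq0 y))) -add_charD subrK mul1r -subr_eq0.
Qed.

(** Two distinct lines have [\tr (L x *m L y) = (p + 1) / 4], whereas
[\tr (L x *m L x) = d ^ 2]; these agree only for [p = 3]. *)
Lemma paley_line_inj : injective L.
Proof.
move=> x y Lxy; apply/eqP; apply: contraT => xy.
have := line2_trace x y; rewrite -Lxy line2_trace subrr residue_sum0.
have yx0 : y - x != 0 by rewrite subr_eq0 eq_sym.
rewrite -[x - y]opprB -residue_sumC.
have -> : residue_sum (y - x) * (residue_sum (y - x))^* = p.+1%:R / 4.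
  have := residue_sumP yx0; rewrite !inE => /orP[] /eqP ->.
    exact: residue_sum_normE.
  by rewrite conjCK mulrC residue_sum_normE.
have n4 : 4 != 0 :> C by rewrite pnatr_eq0.
move/(congr1 ( *%R^~ 4)); rewrite divfK // -!natrM => /eqP.
rewrite eqr_nat => /eqP.
by have := half_double; have := half_gt1; move: d => e; nia.
Qed.

(** The trace of a product of three lines is unchanged by a simultaneous unitary
conjugation. *)
Lemma line_induces_triple (U : 'M[C]_d) (s : {perm 'F_p}) (x y z : 'F_p) :
    line_induces Phi U s ->
  residue_sum (s y - s x) * residue_sum (s z - s y) * residue_sum (s x - s z)
    = residue_sum (y - x) * residue_sum (z - y) * residue_sum (x - z).
Proof.
case=> uU UL; rewrite -!line3_trace -!UL !mulmxA !mulmxKtV //.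
by rewrite mxtrace_mulC !mulmxA -[_ *m U]mul1mx mulmxA mulmxKtV // mul1mx.
Qed.

(** * Line symmetries are affine with square slope *)

Lemma residue_sum_cocycle (s : {perm 'F_p}) :
  (forall x y z,
    residue_sum (s y - s x) * residue_sum (s z - s y) * residue_sum (s x - s z)
      = residue_sum (y - x) * residue_sum (z - y) * residue_sum (x - z)) ->
  forall x y z,
    residue_sum (s y - s x) + residue_sum (s z - s y) + residue_sum (s x - s z)
      = residue_sum (y - x) + residue_sum (z - y) + residue_sum (x - z).
Proof.
move=> prodE x y z.
have sne u v : u != v -> s u - s v != 0.
  by move=> uv; rewrite subr_eq0 (inj_eq perm_inj).
have ne u v : u != v -> u - v != 0 :> 'F_p by rewrite subr_eq0.
(* Degenerate triples: S(t) + S(-t) does not depend on t, if t is not zero. *)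
have pair u v : residue_sum (s u - s v) + residue_sum (s v - s u)
    = residue_sum (u - v) + residue_sum (v - u).
  have [->|uv] := eqVneq u v; first by rewrite !subrr.
  rewrite -(opprB (s u)) -(opprB u) !residue_sum_opp //.
    exact: ne.
  exact: sne.
have [->|xy] := eqVneq x y.
  by rewrite !subrr -!addrA pair.
have [->|yz] := eqVneq y z.
  by rewrite !subrr -!addrA ![residue_sum 0 + _]addrC !addrA pair.
have [->|zx] := eqVneq z x.
  by rewrite !subrr pair.
apply: (sum_of_product residue_sum1_neq0 _ residue_sum1_powers _ (prodE x y z)).
  by rewrite conjC_eq0 residue_sum1_neq0.
have [yx zy xz] : [/\ y != x, z != y & x != z] by split; rewrite eq_sym.
by rewrite /= !residue_sumP //; do ?[exact: ne | exact: sne].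
Qed.

(** Summing over [z], the terms that involve [z] add up to zero. *)
Lemma residue_sum_rigid (s : {perm 'F_p}) :
  (forall x y z,
    residue_sum (s y - s x) + residue_sum (s z - s y) + residue_sum (s x - s z)
      = residue_sum (y - x) + residue_sum (z - y) + residue_sum (x - z)) ->
  forall x y, residue_sum (s y - s x) = residue_sum (y - x).
Proof.
move=> sumE x y.
have out u : \sum_(z : 'F_p) residue_sum (z - u) = 0.
  by rewrite -[RHS]residue_sum_total [RHS](reindex_inj (addIr (- u))).
have inn u : \sum_(z : 'F_p) residue_sum (u - z) = 0.
  by rewrite -[RHS]residue_sum_total [RHS](reindex_inj (subrI u)).
have sreindex (h : 'F_p -> C) : \sum_z h (s z) = \sum_z h z.
  by rewrite [RHS](reindex_inj (@perm_inj _ s)).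
have : \sum_(z : 'F_p) _ = \sum_(z : 'F_p) _ :=
  eq_bigr _ (fun z _ => sumE x y z).
rewrite !big_split /= (sreindex (fun z => residue_sum (z - s y))).
rewrite (sreindex (fun z => residue_sum (s x - z))) !out !inn !addr0.
rewrite !sumr_const card_Fp //.
exact/pmulrnI/prime_gt0.
Qed.

Lemma Sym_l_exp_half (s : {perm 'F_p}) : s \in Sym_l Phi ->
  forall x y, (s x - s y) ^+ d = (x - y) ^+ d.
Proof.
rewrite inE => /asboolP[U Us] x y.
have [->|xy] := eqVneq x y; first by rewrite !subrr.
apply: residue_sum_exp; rewrite ?subr_eq0 ?(inj_eq perm_inj) //.
apply: residue_sum_rigid; apply: residue_sum_cocycle => u v w.
exact: line_induces_triple Us.
Qed.

Lemma AGL_QRP (s : {perm 'F_p}) :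
  reflect (exists2 m : {unit 'F_p}, m \in QR p
             & exists b, forall x, s x = FinRing.uval m * x + b)
          (s \in AGL_QR p).
Proof.
apply: (iffP setIdP) => [[_ /existsP[m /andP[mQ /existsP[b]]]]|[m mQ [b sP]]].
  by move/forallP => sP; exists m => //; exists b => x; apply/eqP.
have msb : affine s m b by apply/forallP => x; rewrite sP.
split; last by apply/existsP; exists m; rewrite mQ; apply/existsP; exists b.
by rewrite inE; apply/existsP; exists m; apply/existsP; exists b.
Qed.

Lemma Sym_l_sub_AGL_QR : Sym_l Phi \subset AGL_QR p.
Proof.
apply/subsetP => s /Sym_l_exp_half sE.
have d2p : (d.*2 < p)%N by rewrite half_double ltn_predL prime_gt0.
have [m [b sP]] := power_preserving_affine p_prime half_gt1 d2p sE.
have md : m ^+ d = 1.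
  by have := sE 1 0; rewrite !sP mulr0 add0r addrK mulr1 subr0 expr1n.
have [u um] := unit_of (square_neq0 (introT eqP md)).
apply/AGL_QRP; exists u; first by rewrite QR_exp_half um md.
by exists b => x; rewrite um.
Qed.

(** * The group generated by modulation and translation *)

Lemma modulation_frame (k : nat) (y : 'F_p) :
  modulation zeta alpha ^+ k *m Phi y = Phi (y + k%:R).
Proof.
elim: k y => [|k IHk] y; first by rewrite expr0 mul1mx addr0.
rewrite exprSr -mulmxE -mulmxA.
suff -> : modulation zeta alpha *m Phi y = Phi (y + 1).
  by rewrite IHk -addrA nat1r.
apply/matrixP => i j; rewrite ord1 mul_diag_mx mxE !paley_frameE mxE.
by rewrite -!/(add_char _) -add_charD mulrDr mulr1 addrC.
Qed.

Lemma paley_row_ordS (i : 'I_d) :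
  paley_row alpha (ordS i) = FinRing.uval (alpha ^+ 2)%g * paley_row alpha i.
Proof.
rewrite /paley_row -FinRing.val_unitM -expgD -!mul2n -mulnS !expgM.
congr FinRing.uval; apply/eqP.
by rewrite eq_expg_mod_order order_alpha2 /= modn_mod.
Qed.

(** Shifting the rows multiplies their labels by [alpha ^+ 2], which amounts to
dividing the label of the column by [alpha ^+ 2]. *)
Lemma translation_frame (l : nat) (y : 'F_p) :
  translation C d ^+ l *m Phi (FinRing.uval (alpha ^+ 2 ^+ l)%g * y) = Phi y.
Proof.
elim: l y => [|l IHl] y; first by rewrite expr0 mul1mx mul1r.
rewrite exprS -mulmxE -mulmxA expgSr FinRing.val_unitM -mulrA IHl.
apply/matrixP => i j; rewrite ord1 -(ord_predK i); move: (ord_pred i) => k.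
rewrite !mxE (bigD1 k) //= big1 => [|k' k'k].
  rewrite addr0 mxE eqxx mul1r !paley_frameE paley_row_ordS.
  by rewrite mulrA [X in add_char (X * _)]mulrC.
rewrite mxE; case: eqP => [kk'|]; last by rewrite mul0r.
by case/eqP: k'k; apply/ordS_inj/val_inj.
Qed.

(** Unitarity is automatic: conjugation by [U] permutes the summands of the frame
operator [p%:R%:M], so that [U *m p%:R%:M *m U^t* = p%:R%:M]. *)
Lemma vector_induces_of_frame (U : 'M[C]_d) (s : {perm 'F_p}) :
  (forall y, U *m Phi y = Phi (s y)) -> vector_induces Phi U s.
Proof.
move=> Us; split => //; apply/unitarymxP.
have p0 : p%:R != 0 :> C by rewrite pnatr_eq0 -lt0n prime_gt0.
have : U *m (\sum_(y : 'F_p) Phi y *m (Phi y)^t* ) *m U^t*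
    = \sum_(y : 'F_p) Phi y *m (Phi y)^t*.
  rewrite mulmx_sumr mulmx_suml [RHS](reindex_inj (@perm_inj _ s)).
  by apply: eq_bigr => y _; rewrite -!Us trmx_mul map_mxM !mulmxA.
rewrite paley_tight mul_mx_scalar -scalemxAl -[RHS]scalemx1.
exact: scalerI.
Qed.

Lemma paley_group_induces (k l : nat) (s : {perm 'F_p}) :
  (forall y, s y = FinRing.uval ((alpha ^+ 2) ^- l)%g * y + k%:R) ->
  vector_induces Phi (modulation zeta alpha ^+ k *m translation C d ^+ l) s.
Proof.
move=> sP; apply: vector_induces_of_frame => y.
set x := FinRing.uval ((alpha ^+ 2) ^- l)%g * y.
have yE : FinRing.uval ((alpha ^+ 2) ^+ l)%g * x = y.
  by rewrite /x mulrA -FinRing.val_unitM mulgV mul1r.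
by rewrite -mulmxA -{1}yE translation_frame modulation_frame sP.
Qed.

Lemma AGL_QR_paley (s : {perm 'F_p}) : s \in AGL_QR p ->
  exists2 U, paley_group zeta alpha U & vector_induces Phi U s.
Proof.
case/AGL_QRP => m mQ [b sP].
have /cyclePmin[l ld mE] : m^-1%g \in <[alpha ^+ 2]>%g by rewrite -QR_cycle groupV.
exists (modulation zeta alpha ^+ b *m translation C d ^+ l).
  exists b, l; split=> //; last by rewrite -order_alpha2.
  by have := ltn_ord b; rewrite [X in (_ < X)%N]Fp_cast.
apply: paley_group_induces => y.
by rewrite -mE invgK sP natr_Zp.
Qed.

Lemma paley_AGL_QR (U : 'M[C]_d) : paley_group zeta alpha U ->
  exists2 s, s \in AGL_QR p & vector_induces Phi U s.
Proof.
case=> k [l [_ _ ->]]; set m := ((alpha ^+ 2) ^- l)%g.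
have inj : injective (fun y : 'F_p => FinRing.uval m * y + k%:R).
  by move=> x y /addIr /(mulfI (uval_neq0 m)).
exists (perm inj); last by apply: paley_group_induces => y; rewrite permE.
apply/AGL_QRP; exists m; first by rewrite QR_cycle groupV mem_cycle.
by exists k%:R => x; rewrite permE.
Qed.

Lemma Sym_v_eq_AGL_QR : Sym_v Phi = AGL_QR p.
Proof.
apply/eqP; rewrite eqEsubset; apply/andP; split; apply/subsetP => s.
  rewrite inE => /asboolP[U Us]; apply: (subsetP Sym_l_sub_AGL_QR).
  by rewrite inE; apply/asboolP; exists U; exact: vector_line_induces.
by case/AGL_QR_paley => U _ Us; rewrite inE; apply/asboolP; exists U.
Qed.

Lemma Sym_l_eq_AGL_QR : Sym_l Phi = AGL_QR p.
Proof.
apply/eqP; rewrite eqEsubset Sym_l_sub_AGL_QR -Sym_v_eq_AGL_QR /=.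
apply/subsetP => s; rewrite !inE => /asboolP[U Us].
by apply/asboolP; exists U; exact: vector_line_induces.
Qed.

Lemma vector_automorphismP (U : 'M[C]_d) :
  vector_automorphism Phi U <-> paley_group zeta alpha U.
Proof.
split=> [[s Us]|/paley_AGL_QR[s _ Us]]; last by exists s.
have /AGL_QR_paley[V GV [_ Vs]] : s \in AGL_QR p.
  by rewrite -Sym_v_eq_AGL_QR inE; apply/asboolP; exists U.
by rewrite (@paley_frame_span U V) // => y; rewrite Vs; case: Us => _ ->.
Qed.

(** The inverse makes this a homomorphism: permutations compose from left to right,
matrices from right to left. If [U] induces [s^-1], then
tightness gives [U = p^-1 * \sum_y (U *m Phi y) *m (Phi y)^t*], which is this
formula. *)
Definition perm_operator (s : {perm 'F_p}) : 'M[C]_d :=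
  p%:R^-1 *: \sum_(y : 'F_p) Phi (s^-1%g y) *m (Phi y)^t*.

Lemma perm_operatorE (s : {perm 'F_p}) (U : 'M[C]_d) :
  vector_induces Phi U s^-1%g -> perm_operator s = U.
Proof.
case=> _ Us; rewrite /perm_operator; under eq_bigr do rewrite -Us -mulmxA.
rewrite -mulmx_sumr paley_tight mul_mx_scalar scalerA mulVf ?scale1r //.
by rewrite pnatr_eq0 -lt0n prime_gt0.
Qed.

Lemma perm_operator_frame (s : {perm 'F_p}) y :
  s \in Sym_v Phi -> perm_operator s *m Phi y = Phi (s^-1%g y).
Proof.
rewrite -groupV inE => /asboolP[U Us].
by rewrite (perm_operatorE Us); case: Us => _ ->.
Qed.

Lemma paley_group_isog : mx_isog (paley_group zeta alpha) [group of Sym_v Phi].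
Proof.
exists perm_operator; split.
- split.
    apply: paley_frame_span => y.
    by rewrite perm_operator_frame ?group1 // invg1 perm1 mul1mx.
  move=> s t sS tS; apply: paley_frame_span => y.
  rewrite -mulmxA !perm_operator_frame ?groupM //.
  by rewrite invMg permM.
- move=> s t sS tS st; apply: invg_inj; apply/permP => y.
  by apply: paley_frame_inj; rewrite -!perm_operator_frame // st.
move=> A; split=> [/paley_AGL_QR[s sA As]|[s sS ->]].
  exists s^-1%g; first by rewrite groupV /= Sym_v_eq_AGL_QR.
  by rewrite (@perm_operatorE _ A) // invgK.
have /AGL_QR_paley[U GU Us] : s^-1%g \in AGL_QR p.
  by rewrite -Sym_v_eq_AGL_QR groupV.
by rewrite (perm_operatorE Us).
Qed.

(** * Homogeneity and transitivity *)

Lemma AGL_QR_2homogeneous : homogeneous 2 (AGL_QR p).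
Proof.
have ordered (A : {set 'F_p}) :
    #|A| = 2 -> exists x y, (y - x) ^+ d = 1 /\ A = [set x; y].
  move=> /eqP/cards2P[x [y [xy ->]]].
  have := one_of_opp_square (_ : y - x != 0); rewrite opprB subr_eq0 eq_sym.
  move=> /(_ xy); case: eqP => [dyx _|_ /eqP dxy]; first by exists x, y; split.
  by exists y, x; split; rewrite // setUC.
move=> A B /ordered[x [y [xy ->]]] /ordered[u [v [uv ->]]].
have yx0 : y - x != 0 by apply: square_neq0; rewrite xy.
set m := (v - u) / (y - x).
have md : m ^+ d == 1 by rewrite exprMn exprVn xy uv invr1 mulr1.
have [w wm] := unit_of (square_neq0 md).
have inj : injective (fun z : 'F_p => m * z + (u - m * x)).
  by move=> z1 z2 /addIr /(mulfI (square_neq0 md)).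
exists (perm inj).
  apply/AGL_QRP; exists w; first by rewrite QR_exp_half wm.
  by exists (u - m * x) => z; rewrite permE wm.
rewrite imsetU1 imset_set1 !permE addrC subrK addrCA -mulrBr divfK //.
by rewrite addrC subrK.
Qed.

Lemma AGL_QR_not_2transitive : ~~ [transitive^2 AGL_QR p, on [set: 'F_p] | 'P].
Proof.
apply/negP => tr.
have dt (x y : 'F_p) : x != y -> [tuple x; y] \in 2.-dtuple([set: 'F_p]).
  by move=> xy; rewrite inE /= inE xy /=; apply/subsetP => z _; rewrite inE.
have n01 : (0 : 'F_p) != 1 by rewrite eq_sym oner_eq0.
(* A map of slope m and intercept b that swaps 0 and 1 has b = 1 and m = -1. *)
have [s sA /(congr1 val) /= []] := atransP2 tr (dt _ _ n01) (dt _ _ (oner_neq0 _)).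
rewrite /aperm; case/AGL_QRP: sA => m mQ [b sP]; rewrite !sP mulr0 add0r => <-.
move/esym/eqP; rewrite mulr1 addr_eq0 => /eqP mE.
move: mQ; rewrite QR_exp_half mE opp_exp_half expr1n.
by rewrite (negPf neg1_neq1).
Qed.

(** * The semidirect product *)

Section SemidirectProduct.
Variable iota : {morphism Zp d >-> {unit 'F_p}}.
Hypothesis iota_isom : isom (Zp d) (QR p) iota.
Local Notation sdT := (sdprod_by ('U \o iota)%gact).

(** The pair [u] stands for its multiplicative component followed by its additive
one, hence first the scaling and then the shift. *)
Definition sd_fun (u : sdT) (y : 'F_p) : 'F_p := FinRing.uval (iota u.1) * y + u.2.

Lemma sd_fun_inj u : injective (sd_fun u).
Proof. by move=> x y /addIr /(mulfI (uval_neq0 _)). Qed.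

Definition sd_perm (u : sdT) : {perm 'F_p} := perm (@sd_fun_inj u).

Lemma sd_dom (u : sdT) : u.1 \in Zp d.
Proof. by case: u => -[a x] /= /setXP[/morphpreP[]]. Qed.

Lemma sd_permM : {in Fp_sdprod iota &, {morph sd_perm : u v / (u * v)%g}}.
Proof.
move=> u v _ _; apply/permP => y; rewrite permM !permE /sd_fun.
rewrite [(u * v)%g.1]/= morphM ?sd_dom //= mulrDr addrA mulrA.
by congr (_ * _ + _ + _); exact: mulrC.
Qed.

Canonical sd_morphism := Morphism sd_permM.

Lemma Fp_sdprod_isog : Fp_sdprod iota \isog AGL_QR p.
Proof.
have [iota_inj iota_im] := isomP iota_isom.
apply/isogP; exists sd_morphism.
  apply/injmP => u v _ _ /= /permP uv; apply/val_inj.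
  have uv2 : u.2 = v.2.
    by have := uv 0; rewrite !permE /sd_fun !mulr0 !add0r.
  have uv1 : u.1 = v.1.
    apply: (injmP iota_inj); rewrite ?sd_dom //; apply: uval_inj.
    by have := uv 1; rewrite !permE /sd_fun !mulr1 uv2 => /addIr.
  by case: u v uv1 uv2 {uv} => -[a x] ux [[b y] vy] /= -> ->.
apply/setP => s; apply/morphimP/AGL_QRP => [[u _ _ ->]|[m mQ [b sP]]].
  exists (iota u.1); first by rewrite -iota_im mem_morphim ?sd_dom.
  by exists u.2 => x; rewrite permE.
move: mQ; rewrite -iota_im => /morphimP[a aZ _ mE].
have ab : (a, b) \in setX (iota @*^-1 [set: {unit 'F_p}])%g [set: 'F_p].
  by apply/setXP; rewrite !inE aZ.
exists (SdPair ('U \o iota)%gact ab); rewrite ?inE //.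
by apply/permP => x; rewrite permE sP mE.
Qed.

End SemidirectProduct.

End Paley.

Theorem theorem2p10 (R : realType) (p : nat) (zeta : R[i]) (alpha : {unit 'F_p})
    (p_prime : prime p) (p_gt3 : (3 < p)%N) (p_mod4 : (p %% 4 = 3)%N)
    (zeta_prim : p.-primitive_root zeta)
    (alpha_prim : generator [set: {unit 'F_p}] alpha) :
  let d := p.-1./2 in
  let Phi := paley_frame zeta alpha in
  let G := paley_group zeta alpha in
  [/\ forall U : 'M[R[i]]_d, vector_automorphism Phi U <-> G U,
      (* the action of Z_d comes from any identification with QR(F_p); one exists *)
      Zp d \isog QR p /\
      (forall iota : {morphism Zp d >-> {unit 'F_p}}, isom (Zp d) (QR p) iota ->
        mx_isog G [group of Fp_sdprod iota]
        /\ Fp_sdprod iota \isog AGL_QR p),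
      Sym_v Phi = Sym_l Phi /\ mx_isog G [group of Sym_v Phi],
      (* injectivity: the action on the vectors (lines) is the one on labels *)
      [/\ injective Phi, homogeneous 2 (Sym_v Phi)
        & ~~ [transitive^2 Sym_v Phi, on [set: 'F_p] | 'P]]
    & [/\ injective (line Phi), homogeneous 2 (Sym_l Phi)
        & ~~ [transitive^2 Sym_l Phi, on [set: 'F_p] | 'P]]].
Proof.
move=> d Phi G.
have Sv : Sym_v Phi = AGL_QR p by exact: Sym_v_eq_AGL_QR.
have Sl : Sym_l Phi = AGL_QR p by exact: Sym_l_eq_AGL_QR.
have Giso : mx_isog G [group of Sym_v Phi] by exact: paley_group_isog.
split.
- by move=> U; exact: vector_automorphismP.
- split=> [|iota iota_isom]; first exact: (QR_isog _ _ _ alpha_prim).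
  have sd_isog := Fp_sdprod_isog iota_isom.
  by split=> //; apply: mx_isog_isog Giso _; rewrite /= Sv.
- by split=> //; rewrite Sv Sl.
- split; [exact: paley_frame_inj | |]; rewrite Sv.
    exact: AGL_QR_2homogeneous.
  exact: AGL_QR_not_2transitive.
- split; [exact: paley_line_inj | |]; rewrite Sl.
    exact: AGL_QR_2homogeneous.
  exact: AGL_QR_not_2transitive.
Qed.
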